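(* If $\mathsf{B}$ is a (not necessarily univalent) bicategory and $\mathsf{C}$ is a univalent bicategory, then the bicategory $\mathsf{Pseudo}(\mathsf{B},\mathsf{C})$ of pseudofunctors from $\mathsf{B}$ to $\mathsf{C}$ is univalent.
   Context: We work in Martin-Löf type theory with function extensionality (univalent foundations). A bicategory $\mathsf{B}$ has a type $\mathsf{B}_0$ of objects, types $\mathsf{B}_1(a,b)$ of 1-cells $a\to b$, and sets $\mathsf{B}_2(f,g)$ of 2-cells $f\Rightarrow g$ (no truncation on objects or 1-cells), with identities, composition $f\cdot g$ of 1-cells (diagrammatic order), vertical composition $\bullet$, whiskerings, invertible unitors and associators, satisfying the usual axioms. An invertible 2-cell is a 2-cell with a two-sided inverse for $\bullet$; $\mathsf{inv2cell}(f,g)$ is the type of these. An adjoint equivalence $a\simeq b$ is a 1-cell $f:a\to b$ with $g:b\to a$ and invertible 2-cells $\eta:\mathrm{id}_1(a)\Rightarrow f\cdot g$, $\varepsilon:g\cdot f\Rightarrow\mathrm{id}_1(b)$ satisfying the two triangle identities. $\mathsf{B}$ is locally univalent if all canonical maps $(f=g)\to\mathsf{inv2cell}(f,g)$ (sending $\mathsf{refl}$ to $\mathrm{id}_2$) are equivalences; globally univalent if all canonical maps $(a=b)\to(a\simeq b)$ (sending $\mathsf{refl}$ to $\mathrm{id}_1$) are equivalences; univalent if both. $\mathsf{Pseudo}(\mathsf{B},\mathsf{C})$ has as objects pseudofunctors $F:\mathsf{B}\to\mathsf{C}$ (functions $F_0,F_1,F_2$ on objects, 1-cells, 2-cells, with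 invertible 2-cells $\mathrm{id}_1(F_0(a))\Rightarrow F_1(\mathrm{id}_1(a))$ and $F_1(f)\cdot F_1(g)\Rightarrow F_1(f\cdot g)$ satisfying the usual functoriality, naturality, unit and associativity laws), as 1-cells pseudotransformations $\eta:F\Rightarrow G$ (1-cells $\eta_0(a):F_0(a)\to G_0(a)$ and invertible 2-cells $\eta_1(f):\eta_0(a)\cdot G_1(f)\Rightarrow F_1(f)\cdot\eta_0(b)$, natural with respect to 2-cells and compatible with identitors and compositors), and as 2-cells modifications (families of 2-cells $\Gamma(a):\eta_0(a)\Rightarrow\theta_0(a)$ with $\eta_1(f)\bullet(F_1(f)\vartriangleleft\Gamma(b))=(\Gamma(a)\vartriangleright G_1(f))\bullet\theta_1(f)$), with pointwise operations. *)

(* Defs.v *)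
From Stdlib Require Import ssreflect FunctionalExtensionality HLevels.

Set Implicit Arguments.
Unset Strict Implicit.
Unset Printing Implicit Defensive.

(** Identity types are Rocq's [eq].  Objects and 1-cells of bicategories carry
    no truncation hypothesis, and neither UIP nor proof irrelevance is used
    below; the only axiom is function extensionality.  Properties that are
    truncated only up to homotopy (being an equivalence, being univalent) live
    in [Type], so that nothing gets propositionally truncated by [Prop]. *)

Definition is_contr (A : Type) : Type := {x : A & forall y : A, y = x}.

Definition is_equiv (A B : Type) (f : A -> B) : Type :=
  forall y : B, is_contr {x : A & f x = y}.

Declare Scope bicat_scope.
Delimit Scope bicat_scope with bicat.
Open Scope bicat_scope.

Reserved Notation "f '·' g" (at level 45, left associativity).
Reserved Notation "x '•' y" (at level 60, right associativity).
Reserved Notation "f '◁' x" (at level 50, left associativity).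
Reserved Notation "x '▷' g" (at level 50, left associativity).
Reserved Notation "f '⟹' g" (at level 70, no associativity).

Record bicat : Type := Bicat {
  ob :> Type;
  hom : ob -> ob -> Type;
  cell : forall a b : ob, hom a b -> hom a b -> Type
    where "f '⟹' g" := (cell f g);

  id1 : forall a : ob, hom a a;
  comp1 : forall a b c : ob, hom a b -> hom b c -> hom a c
    where "f '·' g" := (comp1 f g);
  id2 : forall (a b : ob) (f : hom a b), f ⟹ f;
  vcomp : forall (a b : ob) (f g h : hom a b), f ⟹ g -> g ⟹ h -> f ⟹ h
    where "x '•' y" := (vcomp x y);
  lwhisker : forall (a b c : ob) (f : hom a b) (g h : hom b c),
      g ⟹ h -> f · g ⟹ f · h
    where "f '◁' x" := (lwhisker f x);
  rwhisker : forall (a b c : ob) (f g : hom a b) (h : hom b c),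
      f ⟹ g -> f · h ⟹ g · h
    where "x '▷' h" := (rwhisker h x);
  lunitor : forall (a b : ob) (f : hom a b), id1 a · f ⟹ f;
  linvunitor : forall (a b : ob) (f : hom a b), f ⟹ id1 a · f;
  runitor : forall (a b : ob) (f : hom a b), f · id1 b ⟹ f;
  rinvunitor : forall (a b : ob) (f : hom a b), f ⟹ f · id1 b;
  lassociator : forall (a b c d : ob) (f : hom a b) (g : hom b c) (h : hom c d),
      f · (g · h) ⟹ (f · g) · h;
  rassociator : forall (a b c d : ob) (f : hom a b) (g : hom b c) (h : hom c d),
      (f · g) · h ⟹ f · (g · h);

  cell_set : forall (a b : ob) (f g : hom a b), IsHSet (f ⟹ g);

  id2_left : forall (a b : ob) (f g : hom a b) (x : f ⟹ g), id2 f • x = x;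
  id2_right : forall (a b : ob) (f g : hom a b) (x : f ⟹ g), x • id2 g = x;
  vassocr : forall (a b : ob) (f g h k : hom a b)
      (x : f ⟹ g) (y : g ⟹ h) (z : h ⟹ k), (x • y) • z = x • (y • z);

  lwhisker_id2 : forall (a b c : ob) (f : hom a b) (g : hom b c),
      f ◁ id2 g = id2 (f · g);
  id2_rwhisker : forall (a b c : ob) (f : hom a b) (g : hom b c),
      id2 f ▷ g = id2 (f · g);
  lwhisker_vcomp : forall (a b c : ob) (f : hom a b) (g h k : hom b c)
      (x : g ⟹ h) (y : h ⟹ k), (f ◁ x) • (f ◁ y) = f ◁ (x • y);
  rwhisker_vcomp : forall (a b c : ob) (f g h : hom a b) (k : hom b c)
      (x : f ⟹ g) (y : g ⟹ h), (x ▷ k) • (y ▷ k) = (x • y) ▷ k;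
  vcomp_whisker : forall (a b c : ob) (f g : hom a b) (h k : hom b c)
      (x : f ⟹ g) (y : h ⟹ k), (x ▷ h) • (g ◁ y) = (f ◁ y) • (x ▷ k);

  vcomp_lunitor : forall (a b : ob) (f g : hom a b) (x : f ⟹ g),
      (id1 a ◁ x) • lunitor g = lunitor f • x;
  vcomp_runitor : forall (a b : ob) (f g : hom a b) (x : f ⟹ g),
      (x ▷ id1 b) • runitor g = runitor f • x;
  lwhisker_lwhisker : forall (a b c d : ob) (f : hom a b) (g : hom b c)
      (h k : hom c d) (x : h ⟹ k),
      (f ◁ (g ◁ x)) • lassociator f g k = lassociator f g h • ((f · g) ◁ x);
  rwhisker_lwhisker : forall (a b c d : ob) (f : hom a b) (g h : hom b c)
      (k : hom c d) (x : g ⟹ h),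
      (f ◁ (x ▷ k)) • lassociator f h k = lassociator f g k • ((f ◁ x) ▷ k);
  rwhisker_rwhisker : forall (a b c d : ob) (f g : hom a b) (h : hom b c)
      (k : hom c d) (x : f ⟹ g),
      (x ▷ (h · k)) • lassociator g h k = lassociator f h k • ((x ▷ h) ▷ k);

  lunitor_linvunitor : forall (a b : ob) (f : hom a b),
      lunitor f • linvunitor f = id2 (id1 a · f);
  linvunitor_lunitor : forall (a b : ob) (f : hom a b),
      linvunitor f • lunitor f = id2 f;
  runitor_rinvunitor : forall (a b : ob) (f : hom a b),
      runitor f • rinvunitor f = id2 (f · id1 b);
  rinvunitor_runitor : forall (a b : ob) (f : hom a b),
      rinvunitor f • runitor f = id2 f;
  lassociator_rassociator :
    forall (a b c d : ob) (f : hom a b) (g : hom b c) (h : hom c d),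
      lassociator f g h • rassociator f g h = id2 (f · (g · h));
  rassociator_lassociator :
    forall (a b c d : ob) (f : hom a b) (g : hom b c) (h : hom c d),
      rassociator f g h • lassociator f g h = id2 ((f · g) · h);

  runitor_rwhisker : forall (a b c : ob) (f : hom a b) (g : hom b c),
      lassociator f (id1 b) g • (runitor f ▷ g) = f ◁ lunitor g;
  lassociator_lassociator : forall (a b c d e : ob)
      (f : hom a b) (g : hom b c) (h : hom c d) (k : hom d e),
      (f ◁ lassociator g h k) • lassociator f (g · h) k • (lassociator f g h ▷ k)
      = lassociator f g (h · k) • lassociator (f · g) h k
}.

Arguments id1 {b0} a : rename.
Arguments id2 {b0 a b} f : rename.
Arguments lunitor {b0 a b} f : rename.
Arguments linvunitor {b0 a b} f : rename.
Arguments runitor {b0 a b} f : rename.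
Arguments rinvunitor {b0 a b} f : rename.
Arguments lassociator {b0 a b c d} f g h : rename.
Arguments rassociator {b0 a b c d} f g h : rename.

Notation "f '⟹' g" := (cell f g) : bicat_scope.
Notation "f '·' g" := (comp1 f g) : bicat_scope.
Notation "x '•' y" := (vcomp x y) : bicat_scope.
Notation "f '◁' x" := (lwhisker f x) : bicat_scope.
Notation "x '▷' h" := (rwhisker h x) : bicat_scope.

Record is_invertible (C : bicat) (a b : C) (f g : hom a b) (x : f ⟹ g) : Type :=
  IsInvertible {
    inv_cell : g ⟹ f;
    vcomp_inv : x • inv_cell = id2 f;
    inv_vcomp : inv_cell • x = id2 g
  }.

Record inv2cell (C : bicat) (a b : C) (f g : hom a b) : Type := Inv2Cell {
  inv2cell_cell :> f ⟹ g;
  inv2cell_inv : is_invertible inv2cell_cell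
}.

Definition inv_of (C : bicat) (a b : C) (f g : hom a b) (x : inv2cell f g)
  : g ⟹ f := inv_cell (inv2cell_inv x).

Section VerticalComposition.
Context {C : bicat}.
Implicit Types a b c d e : C.

Lemma vcomp_cancel_l a b (f g h : hom a b) (x : f ⟹ g) (y z : g ⟹ h)
  (x' : g ⟹ f) : x' • x = id2 g -> x • y = x • z -> y = z.
Proof.
  move=> Hx H.
  by rewrite -(id2_left y) -(id2_left z) -Hx !vassocr H.
Qed.

Lemma vcomp_cancel_r a b (f g h : hom a b) (x y : f ⟹ g) (z : g ⟹ h)
  (z' : h ⟹ g) : z • z' = id2 g -> x • z = y • z -> x = y.
Proof.
  move=> Hz H.
  by rewrite -(id2_right x) -(id2_right y) -Hz -!vassocr H.
Qed.

Lemma vcomp_k2 a b (f g h k : hom a b) (x : f ⟹ g) (y : g ⟹ h) (z : f ⟹ h)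
  (w : h ⟹ k) : x • y = z -> x • (y • w) = z • w.
Proof. by move=> <-; rewrite vassocr. Qed.

Lemma vcomp_k3 a b (f g h k l : hom a b) (x : f ⟹ g) (y : g ⟹ h) (z : h ⟹ k)
  (r : f ⟹ k) (w : k ⟹ l) :
  x • (y • z) = r -> x • (y • (z • w)) = r • w.
Proof. by move=> <-; rewrite !vassocr. Qed.

Lemma lwhisker_inv a b c (f : hom a b) (g h : hom b c) (x : g ⟹ h) (y : h ⟹ g) :
  x • y = id2 g -> (f ◁ x) • (f ◁ y) = id2 _.
Proof. by move=> H; rewrite lwhisker_vcomp H lwhisker_id2. Qed.

Lemma rwhisker_inv a b c (f g : hom a b) (h : hom b c) (x : f ⟹ g) (y : g ⟹ f) :
  x • y = id2 f -> (x ▷ h) • (y ▷ h) = id2 _.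
Proof. by move=> H; rewrite rwhisker_vcomp H id2_rwhisker. Qed.

Lemma lwhisker_eq a b c (f : hom a b) (g h h' k : hom b c)
  (x : g ⟹ h) (y : h ⟹ k) (x' : g ⟹ h') (y' : h' ⟹ k) :
  x • y = x' • y' -> (f ◁ x) • (f ◁ y) = (f ◁ x') • (f ◁ y').
Proof. by move=> H; rewrite !lwhisker_vcomp H. Qed.

Lemma rwhisker_eq a b c (f g g' k : hom a b) (h : hom b c)
  (x : f ⟹ g) (y : g ⟹ k) (x' : f ⟹ g') (y' : g' ⟹ k) :
  x • y = x' • y' -> (x ▷ h) • (y ▷ h) = (x' ▷ h) • (y' ▷ h).
Proof. by move=> H; rewrite !rwhisker_vcomp H. Qed.

End VerticalComposition.

Ltac rwk H :=
  rewrite ?vassocr;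
  first [ rewrite (vcomp_k2 _ H) | rewrite (vcomp_k3 _ H) | rewrite H ];
  rewrite ?vassocr ?id2_left ?id2_right.
Tactic Notation "rw" uconstr(H) := rwk H.

Section Coherence.
Context {C : bicat}.
Implicit Types a b c d e : C.

Lemma lwhisker_lwhisker' a b c d (f : hom a b) (g : hom b c)
  (h k : hom c d) (x : h ⟹ k) :
  ((f · g) ◁ x) • rassociator f g k = rassociator f g h • (f ◁ (g ◁ x)).
Proof.
  apply: (vcomp_cancel_l (rassociator_lassociator f g h)).
  rewrite -vassocr -lwhisker_lwhisker vassocr lassociator_rassociator id2_right.
  by rewrite -vassocr lassociator_rassociator id2_left.
Qed.

Lemma rwhisker_lwhisker' a b c d (f : hom a b) (g h : hom b c)
  (k : hom c d) (x : g ⟹ h) :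
  ((f ◁ x) ▷ k) • rassociator f h k = rassociator f g k • (f ◁ (x ▷ k)).
Proof.
  apply: (vcomp_cancel_l (rassociator_lassociator f g k)).
  rewrite -vassocr -rwhisker_lwhisker vassocr lassociator_rassociator id2_right.
  by rewrite -vassocr lassociator_rassociator id2_left.
Qed.

Lemma rwhisker_rwhisker' a b c d (f g : hom a b) (h : hom b c)
  (k : hom c d) (x : f ⟹ g) :
  ((x ▷ h) ▷ k) • rassociator g h k = rassociator f h k • (x ▷ (h · k)).
Proof.
  apply: (vcomp_cancel_l (rassociator_lassociator f h k)).
  rewrite -vassocr -rwhisker_rwhisker vassocr lassociator_rassociator id2_right.
  by rewrite -vassocr lassociator_rassociator id2_left.
Qed.

Lemma vcomp_linvunitor a b (f g : hom a b) (x : f ⟹ g) :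
  x • linvunitor g = linvunitor f • (id1 a ◁ x).
Proof.
  apply: (vcomp_cancel_l (linvunitor_lunitor f)).
  rewrite -!vassocr -vcomp_lunitor lunitor_linvunitor id2_left.
  by rewrite vassocr lunitor_linvunitor id2_right.
Qed.

Lemma vcomp_rinvunitor a b (f g : hom a b) (x : f ⟹ g) :
  x • rinvunitor g = rinvunitor f • (x ▷ id1 b).
Proof.
  apply: (vcomp_cancel_l (rinvunitor_runitor f)).
  rewrite -!vassocr -vcomp_runitor runitor_rinvunitor id2_left.
  by rewrite vassocr runitor_rinvunitor id2_right.
Qed.

Lemma lwhisker_id_inj a b (f g : hom a b) (x y : f ⟹ g) :
  id1 a ◁ x = id1 a ◁ y -> x = y.
Proof.
  move=> H; apply: (vcomp_cancel_l (linvunitor_lunitor f)).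
  by rewrite -!vcomp_lunitor H.
Qed.

Lemma rwhisker_id_inj a b (f g : hom a b) (x y : f ⟹ g) :
  x ▷ id1 b = y ▷ id1 b -> x = y.
Proof.
  move=> H; apply: (vcomp_cancel_l (rinvunitor_runitor f)).
  by rewrite -!vcomp_runitor H.
Qed.

Lemma runitor_triangle a b c (f : hom a b) (g : hom b c) :
  lassociator f g (id1 c) • runitor (f · g) = f ◁ runitor g.
Proof.
  apply: rwhisker_id_inj; rewrite -rwhisker_vcomp.
  apply: (vcomp_cancel_l (rassociator_lassociator _ _ _)).
  rewrite -rwhisker_lwhisker.
  apply: (vcomp_cancel_l (lwhisker_inv f (rassociator_lassociator _ _ _))).
  rw (lassociator_lassociator _ _ _ _).
  rw (runitor_rwhisker _ _).
  rewrite -lwhisker_lwhisker -runitor_rwhisker -lwhisker_vcomp.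
  by rewrite vassocr.
Qed.

Lemma lunitor_triangle a b c (f : hom a b) (g : hom b c) :
  lassociator (id1 a) f g • (lunitor f ▷ g) = lunitor (f · g).
Proof.
  apply: lwhisker_id_inj; rewrite -lwhisker_vcomp.
  apply: (vcomp_cancel_r (lassociator_rassociator _ _ _)).
  rewrite !vassocr.
  rw (rwhisker_lwhisker _ _ _).
  rewrite -runitor_rwhisker -rwhisker_vcomp.
  rw (lassociator_lassociator _ _ _ _).
  rewrite -rwhisker_rwhisker.
  by rw (runitor_rwhisker _ _).
Qed.

Lemma lunitor_runitor_id a : lunitor (id1 a) = runitor (id1 a).
Proof.
  have H : lunitor (id1 a · id1 a) = id1 a ◁ lunitor (id1 a).
    apply: (vcomp_cancel_r (lunitor_linvunitor _)).
    by rewrite vcomp_lunitor.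
  apply: rwhisker_id_inj.
  apply: (vcomp_cancel_l (rassociator_lassociator _ _ _)).
  by rewrite lunitor_triangle runitor_rwhisker H.
Qed.

Lemma linvunitor_rinvunitor_id a : linvunitor (id1 a) = rinvunitor (id1 a).
Proof.
  apply: (vcomp_cancel_l (linvunitor_lunitor (id1 a))).
  by rewrite lunitor_linvunitor lunitor_runitor_id runitor_rinvunitor.
Qed.

Lemma lunitor_triangle' a b c (f : hom a b) (g : hom b c) :
  rassociator (id1 a) f g • lunitor (f · g) = lunitor f ▷ g.
Proof.
  by rewrite -lunitor_triangle -vassocr rassociator_lassociator id2_left.
Qed.

Lemma runitor_triangle' a b c (f : hom a b) (g : hom b c) :
  rassociator f g (id1 c) • (f ◁ runitor g) = runitor (f · g).
Proof.
  by rewrite -runitor_triangle -vassocr rassociator_lassociator id2_left.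
Qed.

Lemma runitor_rwhisker' a b c (f : hom a b) (g : hom b c) :
  rassociator f (id1 b) g • (f ◁ lunitor g) = runitor f ▷ g.
Proof.
  by rewrite -runitor_rwhisker -vassocr rassociator_lassociator id2_left.
Qed.

Lemma linvunitor_triangle a b c (f : hom a b) (g : hom b c) :
  (linvunitor f ▷ g) • rassociator (id1 a) f g = linvunitor (f · g).
Proof.
  apply: (vcomp_cancel_r (lunitor_linvunitor (f · g))).
  rewrite vassocr lunitor_triangle' linvunitor_lunitor.
  exact: rwhisker_inv (linvunitor_lunitor _).
Qed.

Lemma rinvunitor_triangle a b c (f : hom a b) (g : hom b c) :
  (f ◁ rinvunitor g) • lassociator f g (id1 c) = rinvunitor (f · g).
Proof.
  apply: (vcomp_cancel_r (runitor_rinvunitor (f · g))).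
  rewrite vassocr runitor_triangle rinvunitor_runitor.
  exact: lwhisker_inv (rinvunitor_runitor _).
Qed.

Lemma rinvunitor_lunitor a b c (f : hom a b) (g : hom b c) :
  (rinvunitor f ▷ g) • (rassociator f (id1 b) g • (f ◁ lunitor g)) = id2 (f · g).
Proof. by rewrite runitor_rwhisker'; exact: rwhisker_inv (rinvunitor_runitor _). Qed.

Lemma linvunitor_runitor a b c (f : hom a b) (g : hom b c) :
  (f ◁ linvunitor g) • (lassociator f (id1 b) g • (runitor f ▷ g)) = id2 (f · g).
Proof. by rewrite runitor_rwhisker; exact: lwhisker_inv (linvunitor_lunitor _). Qed.

Lemma pentagon_1 a b c d e (f : hom a b) (g : hom b c) (h : hom c d) (k : hom d e) :
  lassociator (f · g) h k • (rassociator f g h ▷ k)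
  = rassociator f g (h · k) • (f ◁ lassociator g h k) • lassociator f (g · h) k.
Proof.
  apply: (vcomp_cancel_l (rassociator_lassociator f g (h · k))).
  rw (eq_sym (lassociator_lassociator f g h k)).
  rw (rwhisker_inv k (lassociator_rassociator f g h)).
  by rw (lassociator_rassociator f g (h · k)).
Qed.

Lemma pentagon_2 a b c d e (f : hom a b) (g : hom b c) (h : hom c d) (k : hom d e) :
  lassociator f (g · h) k • (lassociator f g h ▷ k)
  = (f ◁ rassociator g h k) • lassociator f g (h · k) • lassociator (f · g) h k.
Proof.
  rewrite -lassociator_lassociator.
  by rw (lwhisker_inv f (rassociator_lassociator g h k)).
Qed.

Lemma pentagon_3 a b c d e (f : hom a b) (g : hom b c) (h : hom c d) (k : hom d e) :
  (lassociator f g h ▷ k) • rassociator (f · g) h k • rassociator f g (h · k)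
  = rassociator f (g · h) k • (f ◁ rassociator g h k).
Proof.
  apply: (vcomp_cancel_l (rassociator_lassociator f (g · h) k)).
  rw (pentagon_2 f g h k).
  rw (lassociator_rassociator (f · g) h k).
  rw (lassociator_rassociator f g (h · k)).
  by rw (lassociator_rassociator f (g · h) k).
Qed.

Lemma id1_triangle_l a :
  linvunitor (id1 a) • (linvunitor (id1 a) ▷ id1 a)
  • rassociator (id1 a) (id1 a) (id1 a)
  • (id1 a ◁ lunitor (id1 a)) • runitor (id1 a) = id2 (id1 a).
Proof.
  rewrite -runitor_rwhisker.
  rw (rassociator_lassociator _ _ _).
  rewrite -lunitor_runitor_id.
  rw (rwhisker_inv _ (linvunitor_lunitor _)).
  exact: linvunitor_lunitor.
Qed.

Lemma id1_triangle_r a :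
  rinvunitor (id1 a) • (id1 a ◁ linvunitor (id1 a))
  • lassociator (id1 a) (id1 a) (id1 a)
  • (lunitor (id1 a) ▷ id1 a) • lunitor (id1 a) = id2 (id1 a).
Proof.
  rewrite {1}lunitor_runitor_id.
  rw (runitor_rwhisker _ _).
  rw (lwhisker_inv _ (linvunitor_lunitor _)).
  by rewrite lunitor_runitor_id rinvunitor_runitor.
Qed.

End Coherence.

Record is_adjoint_equivalence (C : bicat) (a b : C) (f : hom a b) : Type :=
  IsAdjointEquivalence {
    ae_right : hom b a;
    ae_unit : inv2cell (id1 a) (f · ae_right);
    ae_counit : inv2cell (ae_right · f) (id1 b);
    ae_triangle_l :
      linvunitor f • (ae_unit ▷ f) • rassociator f ae_right f
      • (f ◁ ae_counit) • runitor f = id2 f;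
    ae_triangle_r :
      rinvunitor ae_right • (ae_right ◁ ae_unit)
      • lassociator ae_right f ae_right
      • (ae_counit ▷ ae_right) • lunitor ae_right = id2 ae_right
  }.

Record adjoint_equivalence (C : bicat) (a b : C) : Type := AdjointEquivalence {
  ae_hom :> hom a b;
  ae_is_adjoint_equivalence : is_adjoint_equivalence ae_hom
}.

Definition id2_inv2cell (C : bicat) (a b : C) (f : hom a b) : inv2cell f f :=
  Inv2Cell (IsInvertible (id2_left (id2 f)) (id2_left (id2 f))).

Definition linvunitor_inv2cell (C : bicat) (a b : C) (f : hom a b)
  : inv2cell f (id1 a · f) :=
  Inv2Cell (IsInvertible (linvunitor_lunitor f) (lunitor_linvunitor f)).

Definition lunitor_inv2cell (C : bicat) (a b : C) (f : hom a b)
  : inv2cell (id1 a · f) f :=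
  Inv2Cell (IsInvertible (lunitor_linvunitor f) (linvunitor_lunitor f)).

Definition id1_adjoint_equivalence (C : bicat) (a : C) : adjoint_equivalence a a :=
  AdjointEquivalence
    (@IsAdjointEquivalence C a a (id1 a) (id1 a)
       (linvunitor_inv2cell (id1 a)) (lunitor_inv2cell (id1 a))
       (id1_triangle_l a) (id1_triangle_r a)).

Definition idtoiso_2_1 (C : bicat) (a b : C) (f g : hom a b) (p : f = g)
  : inv2cell f g :=
  match p in _ = g return inv2cell f g with eq_refl => id2_inv2cell f end.

Definition idtoiso_2_0 (C : bicat) (a b : C) (p : a = b)
  : adjoint_equivalence a b :=
  match p in _ = b return adjoint_equivalence a b with
  | eq_refl => id1_adjoint_equivalence a
  end.

Definition is_locally_univalent (C : bicat) : Type :=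
  forall (a b : C) (f g : hom a b), is_equiv (@idtoiso_2_1 C a b f g).

Definition is_globally_univalent (C : bicat) : Type :=
  forall a b : C, is_equiv (@idtoiso_2_0 C a b).

Definition is_univalent (C : bicat) : Type :=
  (is_locally_univalent C * is_globally_univalent C)%type.

Record psfunctor (B C : bicat) : Type := PsFunctor {
  psf_ob :> B -> C;
  psf_hom : forall a b : B, hom a b -> hom (psf_ob a) (psf_ob b);
  psf_cell : forall (a b : B) (f g : hom a b),
      f ⟹ g -> psf_hom f ⟹ psf_hom g;
  psf_id : forall a : B, inv2cell (id1 (psf_ob a)) (psf_hom (id1 a));
  psf_comp : forall (a b c : B) (f : hom a b) (g : hom b c),
      inv2cell (psf_hom f · psf_hom g) (psf_hom (f · g));

  psf_id2 : forall (a b : B) (f : hom a b), psf_cell (id2 f) = id2 (psf_hom f);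
  psf_vcomp : forall (a b : B) (f g h : hom a b) (x : f ⟹ g) (y : g ⟹ h),
      psf_cell (x • y) = psf_cell x • psf_cell y;
  psf_lunitor : forall (a b : B) (f : hom a b),
      (psf_id a ▷ psf_hom f) • psf_comp (id1 a) f • psf_cell (lunitor f)
      = lunitor (psf_hom f);
  psf_runitor : forall (a b : B) (f : hom a b),
      (psf_hom f ◁ psf_id b) • psf_comp f (id1 b) • psf_cell (runitor f)
      = runitor (psf_hom f);
  psf_lassociator : forall (a b c d : B) (f : hom a b) (g : hom b c) (h : hom c d),
      (psf_hom f ◁ psf_comp g h) • psf_comp f (g · h)
      • psf_cell (lassociator f g h)
      = lassociator (psf_hom f) (psf_hom g) (psf_hom h)
        • (psf_comp f g ▷ psf_hom h) • psf_comp (f · g) h;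
  psf_lwhisker : forall (a b c : B) (f : hom a b) (g h : hom b c) (x : g ⟹ h),
      psf_comp f g • psf_cell (f ◁ x) = (psf_hom f ◁ psf_cell x) • psf_comp f h;
  psf_rwhisker : forall (a b c : B) (f g : hom a b) (h : hom b c) (x : f ⟹ g),
      psf_comp f h • psf_cell (x ▷ h) = (psf_cell x ▷ psf_hom h) • psf_comp g h
}.

Arguments psf_hom {B C} F {a b} f : rename.
Arguments psf_cell {B C} F {a b f g} x : rename.
Arguments psf_id {B C} F a : rename.
Arguments psf_comp {B C} F {a b c} f g : rename.

Record pstrans (B C : bicat) (F G : psfunctor B C) : Type := PsTrans {
  pst_ob :> forall a : B, hom (F a) (G a);
  pst_hom : forall (a b : B) (f : hom a b),
      inv2cell (pst_ob a · psf_hom G f) (psf_hom F f · pst_ob b);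

  pst_natural : forall (a b : B) (f g : hom a b) (x : f ⟹ g),
      (pst_ob a ◁ psf_cell G x) • pst_hom g
      = pst_hom f • (psf_cell F x ▷ pst_ob b);
  pst_id : forall a : B,
      (pst_ob a ◁ psf_id G a) • pst_hom (id1 a)
      = runitor (pst_ob a) • linvunitor (pst_ob a) • (psf_id F a ▷ pst_ob a);
  pst_comp : forall (a b c : B) (f : hom a b) (g : hom b c),
      (pst_ob a ◁ psf_comp G f g) • pst_hom (f · g)
      = lassociator (pst_ob a) (psf_hom G f) (psf_hom G g)
        • (pst_hom f ▷ psf_hom G g)
        • rassociator (psf_hom F f) (pst_ob b) (psf_hom G g)
        • (psf_hom F f ◁ pst_hom g)
        • lassociator (psf_hom F f) (psf_hom F g) (pst_ob c)
        • (psf_comp F f g ▷ pst_ob c)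
}.

Arguments pst_hom {B C F G} η {a b} f : rename.

Record modification (B C : bicat) (F G : psfunctor B C) (η θ : pstrans F G) : Type :=
  Modification {
    mod_cell :> forall a : B, η a ⟹ θ a;
    mod_natural : forall (a b : B) (f : hom a b),
        pst_hom η f • (psf_hom F f ◁ mod_cell b)
        = (mod_cell a ▷ psf_hom G f) • pst_hom θ f
  }.

Lemma hset_of_hprop_rel (A : Type) (R : A -> A -> Prop) :
  (forall x y, IsHProp (R x y)) -> (forall x, R x x) ->
  (forall x y, R x y -> x = y) -> IsHSet A.
Proof.
  move=> Rprop Rrefl ReqP x y.
  pose c z (p : x = z) : x = z := ReqP x z (eq_ind x (R x) (Rrefl x) z p).
  have cE z (p : x = z) : p = eq_trans (eq_sym (c x eq_refl)) (c z p).
    by case: z / p; rewrite eq_trans_sym_inv_l.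
  move=> p q; rewrite (cE y p) (cE y q); congr eq_trans.
  by rewrite /c; congr (ReqP x y); apply: Rprop.
Qed.

Lemma modification_eq (B C : bicat) (F G : psfunctor B C) (η θ : pstrans F G)
  (m n : modification η θ) : (forall a, m a = n a) -> m = n.
Proof.
  case: m n => [m Hm] [n Hn] /= H.
  have E : m = n by apply: functional_extensionality_dep.
  case: n / E Hn {H} => Hn; congr Modification.
  do 3 (apply: functional_extensionality_dep => ?).
  exact: cell_set.
Qed.

Lemma modification_set (B C : bicat) (F G : psfunctor B C) (η θ : pstrans F G) :
  IsHSet (modification η θ).
Proof.
  refine (@hset_of_hprop_rel (modification η θ) (fun m n => forall a, m a = n a) _ _ _).
  - by move=> m n; apply: forall_hprop => a; apply: cell_set.
  - by [].
  - exact: modification_eq.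
Qed.

Definition vcomp_inv2cell (C : bicat) (a b : C) (f g h : hom a b)
  (x : inv2cell f g) (y : inv2cell g h) : inv2cell f h.
Proof.
  refine (@Inv2Cell C a b f h (x • y) (IsInvertible (inv_cell := inv_of y • inv_of x) _ _)).
  - abstract (rewrite !vassocr -(vassocr y) (vcomp_inv (inv2cell_inv y)) id2_left;
      exact: (vcomp_inv (inv2cell_inv x))).
  - abstract (rewrite !vassocr -(vassocr _ x) (inv_vcomp (inv2cell_inv x)) id2_left;
      exact: (inv_vcomp (inv2cell_inv y))).
Defined.

Definition lwhisker_inv2cell (C : bicat) (a b c : C) (f : hom a b) (g h : hom b c)
  (x : inv2cell g h) : inv2cell (f · g) (f · h) :=
  Inv2Cell (IsInvertible (lwhisker_inv f (vcomp_inv (inv2cell_inv x)))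
                         (lwhisker_inv f (inv_vcomp (inv2cell_inv x)))).

Definition rwhisker_inv2cell (C : bicat) (a b c : C) (f g : hom a b) (h : hom b c)
  (x : inv2cell f g) : inv2cell (f · h) (g · h) :=
  Inv2Cell (IsInvertible (rwhisker_inv h (vcomp_inv (inv2cell_inv x)))
                         (rwhisker_inv h (inv_vcomp (inv2cell_inv x)))).

Definition rinvunitor_inv2cell (C : bicat) (a b : C) (f : hom a b)
  : inv2cell f (f · id1 b) :=
  Inv2Cell (IsInvertible (rinvunitor_runitor f) (runitor_rinvunitor f)).

Definition lassociator_inv2cell (C : bicat) (a b c d : C)
  (f : hom a b) (g : hom b c) (h : hom c d)
  : inv2cell (f · (g · h)) ((f · g) · h) :=
  Inv2Cell (IsInvertible (lassociator_rassociator f g h)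
                         (rassociator_lassociator f g h)).

Definition rassociator_inv2cell (C : bicat) (a b c d : C)
  (f : hom a b) (g : hom b c) (h : hom c d)
  : inv2cell ((f · g) · h) (f · (g · h)) :=
  Inv2Cell (IsInvertible (rassociator_lassociator f g h)
                         (lassociator_rassociator f g h)).

Section PseudofunctorBicategory.
Context {B C : bicat}.
Implicit Types F G H K : psfunctor B C.

Definition id_pstrans_hom F (a b : B) (f : hom a b)
  : inv2cell (id1 (F a) · psf_hom F f) (psf_hom F f · id1 (F b)) :=
  vcomp_inv2cell (lunitor_inv2cell (psf_hom F f)) (rinvunitor_inv2cell (psf_hom F f)).

Definition id_pstrans F : pstrans F F.
Proof.
  refine (@PsTrans B C F F (fun a => id1 (F a)) (@id_pstrans_hom F) _ _ _) => /=.
  - abstract (move=> a b f g x;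
      rw (vcomp_lunitor (psf_cell F x));
      by rw (vcomp_rinvunitor (psf_cell F x))).
  - abstract (move=> a;
      rw (vcomp_lunitor (psf_id F a));
      rw (vcomp_rinvunitor (psf_id F a));
      by rewrite lunitor_runitor_id linvunitor_rinvunitor_id).
  - abstract (move=> a b c f g;
      rw (vcomp_lunitor (psf_comp F f g));
      rw (vcomp_rinvunitor (psf_comp F f g));
      rewrite -!rwhisker_vcomp -!lwhisker_vcomp;
      rw (lunitor_triangle _ _);
      rw (rinvunitor_lunitor _ _);
      by rw (rinvunitor_triangle _ _)).
Defined.

Definition comp_pstrans_hom F G H (η : pstrans F G) (θ : pstrans G H)
  (a b : B) (f : hom a b)
  : inv2cell ((η a · θ a) · psf_hom H f) (psf_hom F f · (η b · θ b)) :=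
  vcomp_inv2cell (rassociator_inv2cell _ _ _)
  (vcomp_inv2cell (lwhisker_inv2cell (η a) (pst_hom θ f))
  (vcomp_inv2cell (lassociator_inv2cell _ _ _)
  (vcomp_inv2cell (rwhisker_inv2cell (θ b) (pst_hom η f))
     (rassociator_inv2cell _ _ _)))).

Definition comp_pstrans F G H (η : pstrans F G) (θ : pstrans G H) : pstrans F H.
Proof.
  refine (@PsTrans B C F H (fun a => η a · θ a) (@comp_pstrans_hom F G H η θ) _ _ _) => /=.
  - abstract (move=> a b f g x;
      rw (lwhisker_lwhisker' _ _ _);
      rw (lwhisker_eq _ (pst_natural θ _));
      rw (rwhisker_lwhisker _ _ _);
      rw (rwhisker_eq _ (pst_natural η _));
      by rewrite rwhisker_rwhisker').
  - abstract (move=> a;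
      rw (lwhisker_lwhisker' _ _ _);
      rw (lwhisker_vcomp _ _ _);
      rewrite pst_id -!lwhisker_vcomp;
      rw (rwhisker_lwhisker _ _ _);
      rw (rwhisker_vcomp _ _ _);
      rewrite pst_id -!rwhisker_vcomp ?vassocr;
      rw (linvunitor_runitor _ _);
      rw (runitor_triangle' _ _);
      rw (rwhisker_rwhisker' _ _ _);
      by rw (linvunitor_triangle _ _)).
  - abstract (move=> a b c f g;
      rw (lwhisker_lwhisker' _ _ _);
      rw (lwhisker_vcomp _ _ _);
      rewrite pst_comp -!lwhisker_vcomp;
      rw (rwhisker_lwhisker _ _ (psf_comp G f g));
      rw (rwhisker_vcomp _ _ _);
      rewrite pst_comp -!rwhisker_vcomp;
      rw (rwhisker_rwhisker' _ _ _);
      rw (lassociator_lassociator _ _ _ _);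
      rw (lwhisker_lwhisker _ _ (pst_hom θ g));
      rw (eq_sym (rwhisker_rwhisker _ _ (pst_hom η f)));
      rw (pentagon_1 (psf_hom F f) (η b) (psf_hom G g) (θ c));
      rw (eq_sym (rwhisker_lwhisker _ _ (pst_hom η g)));
      rw (pentagon_2 (psf_hom F f) (psf_hom F g) (η c) (θ c));
      rw (lassociator_rassociator (psf_hom F f · psf_hom F g) _ _);
      rw (pentagon_1 (η a) (θ a) (psf_hom H f) (psf_hom H g));
      rw (eq_sym (rwhisker_lwhisker _ _ (pst_hom θ f)));
      rw (pentagon_2 (η a) (psf_hom G f) (θ b) (psf_hom H g));
      rw (eq_sym (rwhisker_rwhisker _ _ (pst_hom η f)));
      rw (pentagon_1 (psf_hom F f) (η b) (θ b) (psf_hom H g));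
      rw (lassociator_rassociator (psf_hom F f) (η b · θ b) _);
      rw (lwhisker_inv _ (lassociator_rassociator (η b) (θ b) _));
      rw (eq_sym (lwhisker_lwhisker' _ _ (pst_hom θ g)));
      by rw (vcomp_whisker (pst_hom η f) (pst_hom θ g))).
Defined.

Definition id_modification F G (η : pstrans F G) : modification η η.
Proof.
  refine (@Modification B C F G η η (fun a => id2 (η a)) _).
  abstract (by move=> a b f; rewrite lwhisker_id2 id2_rwhisker id2_left id2_right).
Defined.

Definition vcomp_modification F G (η θ μ : pstrans F G)
  (m : modification η θ) (n : modification θ μ) : modification η μ.
Proof.
  refine (@Modification B C F G η μ (fun a => m a • n a) _).
  abstract (move=> a b f; rewrite -lwhisker_vcomp -rwhisker_vcomp;
      rw (mod_natural m f);
      by rw (mod_natural n f)).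
Defined.

Definition lwhisker_modification F G H (η : pstrans F G) (θ μ : pstrans G H)
  (m : modification θ μ) : modification (comp_pstrans η θ) (comp_pstrans η μ).
Proof.
  refine (@Modification B C F H (comp_pstrans η θ) (comp_pstrans η μ)
            (fun a => η a ◁ m a) _) => /=.
  abstract (move=> a b f;
      rw (eq_sym (lwhisker_lwhisker' _ _ (m b)));
      rw (vcomp_whisker (pst_hom η f) (m b));
      rw (eq_sym (lwhisker_lwhisker _ _ (m b)));
      rw (lwhisker_eq _ (mod_natural m f));
      by rw (rwhisker_lwhisker' _ _ (m a))).
Defined.

Definition rwhisker_modification F G H (η θ : pstrans F G) (μ : pstrans G H)
  (m : modification η θ) : modification (comp_pstrans η μ) (comp_pstrans θ μ).
Proof.
  refine (@Modification B C F H (comp_pstrans η μ) (comp_pstrans θ μ)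
            (fun a => m a ▷ μ a) _) => /=.
  abstract (move=> a b f;
      rw (eq_sym (rwhisker_lwhisker' _ _ (m b)));
      rw (rwhisker_eq _ (mod_natural m f));
      rw (eq_sym (rwhisker_rwhisker _ _ (m a)));
      rw (eq_sym (vcomp_whisker (m a) (pst_hom μ f)));
      by rw (rwhisker_rwhisker' _ _ (m a))).
Defined.

Definition lunitor_modification F G (η : pstrans F G)
  : modification (comp_pstrans (id_pstrans F) η) η.
Proof.
  refine (@Modification B C F G (comp_pstrans (id_pstrans F) η) η
            (fun a => lunitor (η a)) _) => /=.
  abstract (move=> a b f; rewrite -!rwhisker_vcomp;
      rw (rinvunitor_lunitor _ _);
      rw (lunitor_triangle _ _);
      rw (vcomp_lunitor (pst_hom η f));
      by rw (lunitor_triangle' _ _)).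
Defined.

Definition runitor_modification F G (η : pstrans F G)
  : modification (comp_pstrans η (id_pstrans G)) η.
Proof.
  refine (@Modification B C F G (comp_pstrans η (id_pstrans G)) η
            (fun a => runitor (η a)) _) => /=.
  abstract (move=> a b f; rewrite -!lwhisker_vcomp;
      rw (runitor_triangle' _ _);
      rw (vcomp_runitor (pst_hom η f));
      rw (runitor_triangle _ _);
      rw (lwhisker_inv _ (rinvunitor_runitor _));
      by rw (runitor_rwhisker' _ _)).
Defined.

Definition lassociator_modification F G H K
  (η : pstrans F G) (θ : pstrans G H) (μ : pstrans H K)
  : modification (comp_pstrans η (comp_pstrans θ μ))
                 (comp_pstrans (comp_pstrans η θ) μ).
Proof.
  refine (@Modification B C F K (comp_pstrans η (comp_pstrans θ μ))
            (comp_pstrans (comp_pstrans η θ) μ)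
            (fun a => lassociator (η a) (θ a) (μ a)) _) => /=.
  abstract (move=> a b f; rewrite -!lwhisker_vcomp -!rwhisker_vcomp;
      rw (eq_sym (pentagon_3 (η a) (θ a) (μ a) (psf_hom K f)));
      rw (eq_sym (lwhisker_lwhisker' _ _ (pst_hom μ f)));
      rw (pentagon_1 (η a) (θ a) (psf_hom H f) (μ b));
      rw (eq_sym (rwhisker_lwhisker _ _ (pst_hom θ f)));
      rw (pentagon_2 (η a) (psf_hom G f) (θ b) (μ b));
      rw (eq_sym (rwhisker_rwhisker _ _ (pst_hom η f)));
      rw (pentagon_1 (psf_hom F f) (η b) (θ b) (μ b));
      by rw (lassociator_rassociator (psf_hom F f) (η b · θ b) _)).
Defined.

Definition inv_modification F G (η θ : pstrans F G) (m : modification η θ)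
  (n : forall a, θ a ⟹ η a)
  (mn : forall a, m a • n a = id2 (η a)) (nm : forall a, n a • m a = id2 (θ a))
  : modification θ η.
Proof.
  refine (@Modification B C F G θ η n _) => a b f.
  abstract (apply: (vcomp_cancel_l (rwhisker_inv _ (nm a)));
      rewrite -[LHS]vassocr -mod_natural vassocr (lwhisker_inv _ (mn b)) id2_right;
      by rewrite -vassocr (rwhisker_inv _ (mn a)) id2_left).
Defined.

Definition linvunitor_modification F G (η : pstrans F G)
  : modification η (comp_pstrans (id_pstrans F) η) :=
  inv_modification (m := lunitor_modification η)
    (fun a => lunitor_linvunitor (η a)) (fun a => linvunitor_lunitor (η a)).

Definition rinvunitor_modification F G (η : pstrans F G)
  : modification η (comp_pstrans η (id_pstrans G)) :=
  inv_modification (m := runitor_modification η)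
    (fun a => runitor_rinvunitor (η a)) (fun a => rinvunitor_runitor (η a)).

Definition rassociator_modification F G H K
  (η : pstrans F G) (θ : pstrans G H) (μ : pstrans H K)
  : modification (comp_pstrans (comp_pstrans η θ) μ)
                 (comp_pstrans η (comp_pstrans θ μ)) :=
  inv_modification (m := lassociator_modification η θ μ)
    (fun a => lassociator_rassociator (η a) (θ a) (μ a))
    (fun a => rassociator_lassociator (η a) (θ a) (μ a)).

End PseudofunctorBicategory.

Definition Pseudo (B C : bicat) : bicat.
Proof.
  refine (@Bicat (psfunctor B C) (@pstrans B C) (@modification B C)
    (@id_pstrans B C) (@comp_pstrans B C) (@id_modification B C)
    (@vcomp_modification B C) (@lwhisker_modification B C)
    (@rwhisker_modification B C)
    (@lunitor_modification B C) (@linvunitor_modification B C)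
    (@runitor_modification B C) (@rinvunitor_modification B C)
    (@lassociator_modification B C) (@rassociator_modification B C)
    (@modification_set B C)
    _ _ _ _ _ _ _ _ _ _ _ _ _ _ _ _ _ _ _ _ _);
    intros; apply: modification_eq => i /=.
  - exact: id2_left.
  - exact: id2_right.
  - exact: vassocr.
  - exact: lwhisker_id2.
  - exact: id2_rwhisker.
  - exact: lwhisker_vcomp.
  - exact: rwhisker_vcomp.
  - exact: vcomp_whisker.
  - exact: vcomp_lunitor.
  - exact: vcomp_runitor.
  - exact: lwhisker_lwhisker.
  - exact: rwhisker_lwhisker.
  - exact: rwhisker_rwhisker.
  - exact: lunitor_linvunitor.
  - exact: linvunitor_lunitor.
  - exact: runitor_rinvunitor.
  - exact: rinvunitor_runitor.
  - exact: lassociator_rassociator.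
  - exact: rassociator_lassociator.
  - exact: runitor_rwhisker.
  - exact: lassociator_lassociator.
Defined.

(* Main.v *)
Require Import Defs.
From Stdlib Require Import ssreflect FunctionalExtensionality HLevels.

Set Implicit Arguments.
Unset Strict Implicit.
Unset Printing Implicit Defensive.

(** By the fundamental theorem of identity types, univalence says that the
    invertible 2-cells out of a fixed 1-cell, and the adjoint equivalences out
    of a fixed object, form contractible types; by function extensionality one
    may then do induction on pointwise families of them.  An invertible
    modification [η ⟹ θ] thus becomes pointwise the identity, and its naturality
    identifies the 2-cells of [η] and [θ].  For an adjoint equivalence [η] from
    [F] to [G], the 1-cells [η a] become identities, then [η_1] turns into
    invertible 2-cells from [F_1] to [G_1], which become identities as well, and
    the laws of [η] identify the remaining data of [F] and [G].  Finally, by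
    local univalence, an identity 1-cell carries only one structure of adjoint
    equivalence.  Everything else is an equation between 2-cells, hence a
    proposition. *)

(** * Contractible total spaces and induction on families *)

(** The pair [(a, r)] is the centre of contraction of [{x & R x}]. *)
Definition based_center (A : Type) (R : A -> Type) (a : A) (r : R a) : Prop :=
  forall (x : A) (s : R x), existT R a r = existT R x s.

Lemma based_center_is_equiv (A : Type) (R : A -> Type) (a : A)
  (φ : forall x, a = x -> R x) :
  based_center (φ a eq_refl) -> forall x, is_equiv (φ x).
Proof.
  move=> H x s.
  have Tset : IsHSet {x & R x}.
    by apply: hset_hprop => -[y t] [z u]; rewrite -(H y t) -(H z u).
  (* The fibre is a retract of an identity type of the contractible total space. *)
  pose enc (z : {x & R x}) (e : existT R a (φ a eq_refl) = z)
    : {p : a = projT1 z & φ _ p = projT2 z} :=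
    match e with eq_refl => existT _ eq_refl eq_refl end.
  exists (enc _ (H x s)) => -[p q].
  case: _ / q; case: _ / p.
  (* After both inductions [s] is [φ a eq_refl]; the loop [H a s] is trivial because the total space
     is a set, so [enc] computes. *)
  by rewrite (Tset _ _ (H a _) eq_refl).
Qed.

Lemma is_equiv_based_center (A : Type) (R : A -> Type) (a : A)
  (φ : forall x, a = x -> R x) :
  (forall x, is_equiv (φ x)) -> based_center (φ a eq_refl).
Proof.
  move=> H x s; case: (H x s) => -[p q] _.
  by case: _ / q; case: _ / p.
Qed.

(** Function extensionality moves all pairs [(t a, r a)] to their centres at once, so [P] may relate
    different indices. *)
Lemma based_center_fam (A : Type) (T : A -> Type) (R : forall a, T a -> Type)
  (t0 : forall a, T a) (r0 : forall a, R a (t0 a))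
  (H : forall a, based_center (r0 a))
  (P : forall t : (forall a, T a), (forall a, R a (t a)) -> Prop) :
  P t0 r0 -> forall t r, P t r.
Proof.
  move=> P0 t r.
  have E : (fun a => existT (R a) (t0 a) (r0 a)) = (fun a => existT (R a) (t a) (r a)).
    by apply: functional_extensionality_dep => a; apply: H.
  pose Q (y : forall a, {x & R a x}) := P (fun a => projT1 (y a)) (fun a => projT2 (y a)).
  change (Q (fun a => existT (R a) (t a) (r a))).
  by case: _ / E.
Qed.

(** * Induction on invertible 2-cells and adjoint equivalences *)

Section InvertibleCells.
Context {C : bicat}.
Implicit Types a b : C.

Lemma is_invertible_hprop a b (f g : hom a b) (x : f ⟹ g) (i j : is_invertible x) :
  i = j.
Proof.
  case: i j => [y xy yx] [z xz zx].
  have E : y = z by apply: (vcomp_cancel_l yx); rewrite xy xz.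
  case: z / E xz zx => xz zx.
  by congr IsInvertible; apply: cell_set.
Qed.

Lemma inv2cell_eq a b (f g : hom a b) (x y : inv2cell f g) :
  inv2cell_cell x = inv2cell_cell y -> x = y.
Proof.
  case: x y => [x i] [y j] /= E.
  by case: y / E j => j; rewrite (is_invertible_hprop i j).
Qed.

Definition inverse_inv2cell a b (f g : hom a b) (x : inv2cell f g) : inv2cell g f :=
  Inv2Cell (IsInvertible (inv_vcomp (inv2cell_inv x)) (vcomp_inv (inv2cell_inv x))).

Hypothesis LU : is_locally_univalent C.

Lemma id2_based_center a b (f : hom a b) :
  based_center (R := inv2cell f) (id2_inv2cell f).
Proof. exact (is_equiv_based_center (φ := @idtoiso_2_1 C a b f) (@LU a b f)). Qed.

(** Postcomposition with the invertible [linvunitor] transfers contractibility from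
    [id2_based_center]. This form fits the unit of an adjoint equivalence on [id1 a]. *)
Lemma linvunitor_based_center a b (f : hom a b) :
  based_center (R := fun g => inv2cell f (id1 a · g)) (linvunitor_inv2cell f).
Proof.
  move=> g x.
  pose T := {g & inv2cell f (id1 a · g)}.
  have H (y : inv2cell f g) :
      existT _ f (linvunitor_inv2cell f)
      = existT _ g (vcomp_inv2cell y (linvunitor_inv2cell g)) :> T.
    refine (match id2_based_center y in _ = z return
      _ = existT _ (projT1 z)
            (vcomp_inv2cell (projT2 z) (linvunitor_inv2cell (projT1 z)))
      with eq_refl => _ end).
    by congr existT; apply: inv2cell_eq; rewrite /= id2_left.
  rewrite (H (vcomp_inv2cell x (lunitor_inv2cell g))).
  congr existT; apply: inv2cell_eq.
  by rewrite /= vassocr lunitor_linvunitor id2_right.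
Qed.

(** This is the shape of the 2-cells of a pseudotransformation with identity components; the centre
    is the 2-cell of the identity one. *)
Lemma unitors_based_center a b (f : hom a b) :
  based_center (R := fun g => inv2cell (id1 a · g) (f · id1 b))
    (vcomp_inv2cell (lunitor_inv2cell f) (rinvunitor_inv2cell f)).
Proof.
  move=> g x.
  pose T := {g & inv2cell (id1 a · g) (f · id1 b)}.
  pose k g (y : inv2cell f g) : inv2cell (id1 a · g) (f · id1 b) :=
    vcomp_inv2cell (lunitor_inv2cell g)
      (vcomp_inv2cell (inverse_inv2cell y) (rinvunitor_inv2cell f)).
  have H (y : inv2cell f g) :
      existT _ f (vcomp_inv2cell (lunitor_inv2cell f) (rinvunitor_inv2cell f))
      = existT _ g (k g y) :> T.
    refine (match id2_based_center y in _ = z return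
      _ = existT _ (projT1 z) (k _ (projT2 z)) with eq_refl => _ end).
    by congr existT; apply: inv2cell_eq; rewrite /= /inv_of /= id2_left.
  (* The [y] that [k] sends to [x]: the inverse of [x], stripped of its unitors. *)
  rewrite (H (vcomp_inv2cell (rinvunitor_inv2cell f)
     (vcomp_inv2cell (inverse_inv2cell x) (lunitor_inv2cell g)))).
  congr existT; apply: inv2cell_eq; rewrite /= /inv_of /= /inv_of /=.
  rw (lunitor_linvunitor g).
  by rewrite runitor_rinvunitor id2_right.
Qed.

(** Right adjoint and unit contract together to [id1 a] and [linvunitor]; the first triangle law
    then determines the counit. *)
Lemma id1_is_adjoint_equivalence_unique a (w : is_adjoint_equivalence (id1 a)) :
  ae_is_adjoint_equivalence (id1_adjoint_equivalence a) = w.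
Proof.
  case: w => [g u e tl tr].
  have E := linvunitor_based_center u.
  pose P (z : {g & inv2cell (id1 a) (id1 a · g)}) :=
    forall (e : inv2cell (projT1 z · id1 a) (id1 a)) tl tr,
      ae_is_adjoint_equivalence (id1_adjoint_equivalence a)
      = @IsAdjointEquivalence C a a (id1 a) (projT1 z) (projT2 z) e tl tr.
  suff: P (existT _ g u) by apply.
  case: _ / E => {g u e tl tr} /= e tl tr.
  have Ee : lunitor_inv2cell (id1 a) = e.
    apply: inv2cell_eq; apply: lwhisker_id_inj.
    apply: (vcomp_cancel_r (runitor_rinvunitor _)).
    apply: (vcomp_cancel_l (lassociator_rassociator _ _ _)).
    apply: (vcomp_cancel_l (rwhisker_inv _ (lunitor_linvunitor _))).
    apply: (vcomp_cancel_l (lunitor_linvunitor _)).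
    by move: tl (id1_triangle_l a); rewrite /= => -> ->.
  case: e / Ee tl tr => tl tr.
  by congr IsAdjointEquivalence; apply: cell_set.
Qed.

(** Keeping invertibility outside [P] lets [P] speak of the bare 2-cells of a modification. *)
Lemma invertible_fam_ind (A : Type) (s t0 : A -> C) (f : forall i, hom (s i) (t0 i))
  (P : forall g : (forall i, hom (s i) (t0 i)), (forall i, f i ⟹ g i) -> Prop) :
  P f (fun i => id2 (f i)) ->
  forall g x, (forall i, is_invertible (x i)) -> P g x.
Proof.
  move=> P0 g x w.
  exact: (based_center_fam (fun i => @id2_based_center _ _ (f i))
    (P := fun g y => P g (fun i => inv2cell_cell (y i))) P0 (fun i => Inv2Cell (w i))).
Qed.

End InvertibleCells.

Lemma adjoint_equivalence_fam_ind (C : bicat) (GU : is_globally_univalent C)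
  (A : Type) (s : A -> C)
  (P : forall t : A -> C, (forall i, hom (s i) (t i)) -> Prop) :
  P s (fun i => id1 (s i)) ->
  forall t f, (forall i, is_adjoint_equivalence (f i)) -> P t f.
Proof.
  move=> P0 t f w.
  have H i : based_center (R := adjoint_equivalence (s i)) (id1_adjoint_equivalence (s i)).
    exact (is_equiv_based_center (φ := @idtoiso_2_0 C (s i)) (@GU (s i))).
  exact: (based_center_fam H (P := fun t y => P t (fun i => ae_hom (y i))) P0
    (fun i => AdjointEquivalence (w i))).
Qed.

Lemma unitors_fam_ind (B C : bicat) (LU : is_locally_univalent C) (s : B -> C)
  (f : forall a b, hom a b -> hom (s a) (s b))
  (P : forall g : (forall a b, hom a b -> hom (s a) (s b)),
      (forall a b (k : hom a b), inv2cell (id1 (s a) · g a b k) (f a b k · id1 (s b))) ->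
      Prop) :
  P f (fun a b k => vcomp_inv2cell (lunitor_inv2cell (f a b k))
                                   (rinvunitor_inv2cell (f a b k))) ->
  forall g h, P g h.
Proof.
  move=> P0 g h.
  (* All 1-cells of [B], bundled with their endpoints, serve as the single index of
     [based_center_fam]. *)
  pose A := {a : B & {b : B & hom a b}}.
  exact (based_center_fam
    (fun i : A => @unitors_based_center _ LU _ _ (f _ _ (projT2 (projT2 i))))
    (P := fun g h => P (fun a b k => g (existT _ a (existT _ b k)))
                       (fun a b k => h (existT _ a (existT _ b k)))) P0
    (t := fun i => g _ _ (projT2 (projT2 i)))
    (fun i => h _ _ (projT2 (projT2 i)))).
Qed.

(** * Univalence of the bicategory of pseudofunctors *)

Ltac law_eq :=
  repeat (apply: functional_extensionality_dep => ?); exact: cell_set.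

Ltac identify_laws p q :=
  let E := fresh in have E : p = q; [law_eq | destruct E].

Section PseudoUnivalence.
Context {B C : bicat} (LU : is_locally_univalent C).

(** Since [Pseudo B C] is pointwise, evaluating an equation of modifications at [a] gives the
    equation in [C] by computation. *)
Definition is_invertible_mod_cell (F G : Pseudo B C) (η θ : hom F G) (m : η ⟹ θ)
  (i : is_invertible m) (a : B) : is_invertible (mod_cell m a) :=
  IsInvertible (f_equal (fun n : modification η η => n a) (vcomp_inv i))
    (f_equal (fun n : modification θ θ => n a) (inv_vcomp i)).

Definition inv2cell_mod_cell (F G : Pseudo B C) (η θ : hom F G) (m : inv2cell η θ) (a : B)
  : inv2cell (pst_ob η a) (pst_ob θ a) :=
  Inv2Cell (is_invertible_mod_cell (inv2cell_inv m) a).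

Definition is_adjoint_equivalence_pst_ob (F G : Pseudo B C) (η : hom F G)
  (w : is_adjoint_equivalence η) (a : B) : is_adjoint_equivalence (pst_ob η a) :=
  @IsAdjointEquivalence C _ _ (pst_ob η a) (pst_ob (ae_right w) a)
    (inv2cell_mod_cell (ae_unit w) a) (inv2cell_mod_cell (ae_counit w) a)
    (f_equal (fun n : modification η η => n a) (ae_triangle_l w))
    (f_equal (fun n : modification (ae_right w) (ae_right w) => n a) (ae_triangle_r w)).

Lemma id_modification_center (F G : psfunctor B C) (η θ : pstrans F G)
  (m : modification η θ) :
  (forall a, is_invertible (m a)) ->
  existT (modification η) η (id_modification η) = existT (modification η) θ m.
Proof.
  case: θ m => [o h nat uni com] [/= m mnat] w.
  move: o m w h nat uni com mnat.
  refine (invertible_fam_ind LU _) => h nat uni com mnat.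
  case: η h nat uni com mnat => [o h0 nat0 uni0 com0] /= h nat uni com mnat.
  have E : h0 = h.
    apply: functional_extensionality_dep => a.
    apply: functional_extensionality_dep => b.
    apply: functional_extensionality_dep => f.
    apply: inv2cell_eq; have := mnat a b f.
    by rewrite /= lwhisker_id2 id2_rwhisker id2_left id2_right.
  case: h / E nat uni com mnat => nat uni com mnat.
  identify_laws nat0 nat; identify_laws uni0 uni; identify_laws com0 com.
  by congr existT; apply: modification_eq.
Qed.

Lemma Pseudo_locally_univalent : is_locally_univalent (Pseudo B C).
Proof.
  move=> F G η.
  refine (based_center_is_equiv (φ := @idtoiso_2_1 (Pseudo B C) F G η) _).
  move=> θ [m i].
  pose P (z : {θ & modification η θ}) :=
    forall i : @is_invertible (Pseudo B C) F G η (projT1 z) (projT2 z),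
      existT (@inv2cell (Pseudo B C) F G η) _ (@id2_inv2cell (Pseudo B C) F G η)
      = existT _ (projT1 z) (Inv2Cell i).
  suff: P (existT _ θ m) by apply.
  case: _ / (id_modification_center (is_invertible_mod_cell i)) => {}i.
  by congr existT; apply: inv2cell_eq.
Qed.

Lemma id_pstrans_center (GU : is_globally_univalent C) (F G : psfunctor B C)
  (η : pstrans F G) :
  (forall a, is_adjoint_equivalence (η a)) ->
  existT (pstrans F) F (id_pstrans F) = existT (pstrans F) G η.
Proof.
  case: G η => [go gh gc gi gm l1 l2 l3 l4 l5 l6 l7] [/= o h nat uni com] w.
  move: go o w gh gc gi gm l1 l2 l3 l4 l5 l6 l7 h nat uni com.
  refine (adjoint_equivalence_fam_ind GU _).
  move=> gh gc gi gm l1 l2 l3 l4 l5 l6 l7 h; move: gh h gc gi gm l1 l2 l3 l4 l5 l6 l7.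
  refine (unitors_fam_ind LU _) => gc gi gm l1 l2 l3 l4 l5 l6 l7 nat uni com.
  have Ec : @psf_cell _ _ F = gc.
    apply: functional_extensionality_dep => a; apply: functional_extensionality_dep => b.
    apply: functional_extensionality_dep => f; apply: functional_extensionality_dep => g.
    apply: functional_extensionality_dep => x.
    (* [nat] and the naturality of [id_pstrans F] have the same right-hand side; cancelling their
       common invertible factor leaves the two 2-cells whiskered by an identity. [Ei] and [Em]
       follow likewise. *)
    apply: lwhisker_id_inj.
    apply: (vcomp_cancel_r (vcomp_inv (inv2cell_inv (id_pstrans_hom F g)))).
    exact: (eq_trans (pst_natural (id_pstrans F) x) (eq_sym (nat _ _ _ _ x))).
  have Ei : @psf_id _ _ F = gi.
    apply: functional_extensionality_dep => a.
    apply: inv2cell_eq; apply: lwhisker_id_inj.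
    apply: (vcomp_cancel_r (vcomp_inv (inv2cell_inv (id_pstrans_hom F (id1 a))))).
    exact: (eq_trans (pst_id (id_pstrans F) a) (eq_sym (uni a))).
  have Em : @psf_comp _ _ F = gm.
    apply: functional_extensionality_dep => a; apply: functional_extensionality_dep => b.
    apply: functional_extensionality_dep => c.
    apply: functional_extensionality_dep => f; apply: functional_extensionality_dep => g.
    apply: inv2cell_eq; apply: lwhisker_id_inj.
    apply: (vcomp_cancel_r (vcomp_inv (inv2cell_inv (id_pstrans_hom F (f · g))))).
    exact: (eq_trans (pst_comp (id_pstrans F) f g) (eq_sym (com _ _ _ f g))).
  case: F gc gi gm l1 l2 l3 l4 l5 l6 l7 nat uni com Ec Ei Em
    => [fo fh fc fi fm k1 k2 k3 k4 k5 k6 k7] /= gc gi gm l1 l2 l3 l4 l5 l6 l7 nat uni com.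
  move=> Ec Ei Em.
  case: gc / Ec l1 l2 l3 l4 l5 l6 l7 nat uni com => l1 l2 l3 l4 l5 l6 l7 nat uni com.
  case: gi / Ei l3 l4 uni nat com => l3 l4 uni nat com.
  case: gm / Em l3 l4 l5 l6 l7 com nat uni => l3 l4 l5 l6 l7 com nat uni.
  identify_laws k1 l1; identify_laws k2 l2; identify_laws k3 l3; identify_laws k4 l4.
  identify_laws k5 l5; identify_laws k6 l6; identify_laws k7 l7.
  by congr existT; congr PsTrans; law_eq.
Qed.

Lemma Pseudo_globally_univalent :
  is_globally_univalent C -> is_globally_univalent (Pseudo B C).
Proof.
  move=> GU F.
  refine (based_center_is_equiv (φ := @idtoiso_2_0 (Pseudo B C) F) _).
  move=> G [η w].
  pose P (z : {G & pstrans F G}) :=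
    forall w : @is_adjoint_equivalence (Pseudo B C) F (projT1 z) (projT2 z),
      existT (@adjoint_equivalence (Pseudo B C) F) _ (@id1_adjoint_equivalence (Pseudo B C) F)
      = existT _ (projT1 z) (AdjointEquivalence w).
  suff: P (existT _ G η) by apply.
  case: _ / (id_pstrans_center GU (is_adjoint_equivalence_pst_ob w)) => {}w.
  (* Uniqueness is applied in [Pseudo B C] itself, which is why its local univalence comes first. *)
  by rewrite -(id1_is_adjoint_equivalence_unique Pseudo_locally_univalent w).
Qed.

End PseudoUnivalence.

Theorem theorem3p20 (B C : bicat) (HC : is_univalent C) : is_univalent (Pseudo B C).
Proof.
  case: HC => LU GU; split.
  - exact: Pseudo_locally_univalent.
  - exact: Pseudo_globally_univalent.
Qed.
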